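(* Let $\mathfrak g$ be a Lie superalgebra over $\mathbb C$ and let $M$ be a $\mathfrak g$-module. Then $$\operatorname{H}^1(\mathfrak g,M)\cong \operatorname{SupDer}(\mathfrak g,M)/\operatorname{InnSupDer}(\mathfrak g,M).$$
   Context: A Lie superalgebra is a $\mathbb Z_2$-graded space $\mathfrak g=\mathfrak g_{\bar0}\oplus\mathfrak g_{\bar1}$ with a bilinear bracket satisfying $[\mathfrak g_i,\mathfrak g_j]\subseteq\mathfrak g_{i+j}$, $[a,b]=-(-1)^{|a||b|}[b,a]$ and $[a,[b,c]]=[[a,b],c]+(-1)^{|a||b|}[b,[a,c]]$ for homogeneous elements; a $\mathfrak g$-module is a $\mathbb Z_2$-graded space with a compatible action of $\mathfrak g$. A superderivation from $\mathfrak g$ to $M$ is a linear map $\phi:\mathfrak g\to M$ satisfying $\phi([x,y])=x\cdot\phi(y)-(-1)^{|x||y|}y\cdot\phi(x)$ for homogeneous $x,y$ (no parity condition on $\phi$). An inner superderivation is one of the form $\phi_a(x)=x\cdot a$ for some $a\in M$. $\operatorname{SupDer}(\mathfrak g,M)$ and $\operatorname{InnSupDer}(\mathfrak g,M)$ denote the vector spaces of superderivations and inner superderivations. $\operatorname{H}^\bullet(\mathfrak g,M)$ is the cohomology of the complex $C^p(\mathfrak g,M)=\operatorname{Hom}(\Lambda^p_s(\mathfrak g),M)$, where $\Lambda_s^p(\mathfrak g)=\bigoplus_{i+j=p}\Lambda^i(\mathfrak g_{\bar0})\otimes S^j(\mathfrak g_{\bar1})$, with differential, for homogeneous $f$, $$df(\omega_0\wedge\cdots\wedge\omega_p)=\sum_{i}(-1)^{\tau_i}\omega_i\cdot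 f(\omega_0\wedge\cdots\widehat{\omega_i}\cdots\wedge\omega_p)+\sum_{i<j}(-1)^{\sigma_{i,j}}f([\omega_i,\omega_j]\wedge\omega_0\wedge\cdots\widehat{\omega_i}\cdots\widehat{\omega_j}\cdots\wedge\omega_p),$$ $\tau_i=i+|\omega_i|(|\omega_0|+\cdots+|\omega_{i-1}|+|f|)$, $\sigma_{i,j}=i+j+|\omega_i||\omega_j|+|\omega_i|(|\omega_0|+\cdots+|\omega_{i-1}|)+|\omega_j|(|\omega_0|+\cdots+|\omega_{j-1}|)$, extended linearly. *)

(* Defs.v *)
From HB Require Import structures.
From mathcomp Require Import all_boot all_algebra.
From mathcomp Require Import boolp functions reals complex.
From mathcomp Require Import freeg.

Set Implicit Arguments.
Unset Strict Implicit.
Unset Printing Implicit Defensive.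

Import GRing.Theory.
Local Open Scope ring_scope.
Local Open Scope quotient_scope.

(* [GRing.submodClosed] does not record closure under opposite, which
   [Quotient.quot] requires; hence this record. *)
Record subspace (K : pzRingType) (V : lmodType K) := Subspace {
  subspace_pred :> {pred V};
  subspaceP : submod_closed subspace_pred
}.

HB.instance Definition _ (K : pzRingType) (V : lmodType K) (A : subspace V) :=
  GRing.isSubmodClosed.Build K V (subspace_pred A) (subspaceP A).

Section Subspaces.
Variables (K : fieldType) (V : lmodType K).

Definition subspace_type (A : subspace V) := {v : V | v \in A}.

HB.instance Definition _ (A : subspace V) := SubChoice.on (subspace_type A).
HB.instance Definition _ (A : subspace V) :=
  [SubChoice_isSubLmodule of subspace_type A by <:].

Definition spanned (S : V -> Prop) : {pred V} := fun v =>
  `[< forall A : subspace V, (forall s, S s -> s \in A) -> v \in A >].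

Lemma spanned_closed S : submod_closed (spanned S).
Proof.
split=> [|a u v /asboolP uS /asboolP vS]; apply/asboolP => A SA.
  exact: rpred0.
by rewrite rpredD ?rpredZ ?uS ?vS.
Qed.

Definition span S : subspace V := Subspace (spanned_closed S).

End Subspaces.

Section Quotient.
Variables (K : fieldType) (V : lmodType K) (A : subspace V).

Definition quotient_space := {ideal_quot A}.

HB.instance Definition _ := GRing.Zmodule.on quotient_space.
HB.instance Definition _ := ZmodQuotient.on quotient_space.

Definition quotient_scale (a : K) : quotient_space -> quotient_space :=
  lift_op1 quotient_space ( *:%R a).

Lemma pi_scale a : {morph \pi_quotient_space : v / a *: v >-> quotient_scale a v}.
Proof.
move=> v; unlock quotient_scale; apply/eqP.
by rewrite -Quotient.idealrBE -scalerBr rpredZ // Quotient.idealrBE reprK.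
Qed.

Fact quotient_scaleA a b v :
  quotient_scale a (quotient_scale b v) = quotient_scale (a * b) v.
Proof. by rewrite -[v]reprK -!pi_scale scalerA. Qed.

Fact quotient_scale1 v : quotient_scale 1 v = v.
Proof. by rewrite -[v]reprK -pi_scale scale1r. Qed.

Fact quotient_scaleDr a u v :
  quotient_scale a (u + v) = quotient_scale a u + quotient_scale a v.
Proof. 
rewrite -[u]reprK -[v]reprK -[\pi _ + \pi _]raddfD -!pi_scale scalerDr.
exact: raddfD.
 Qed.

Fact quotient_scaleDl v a b :
  quotient_scale (a + b) v = quotient_scale a v + quotient_scale b v.
Proof. by rewrite -[v]reprK -!pi_scale scalerDl; exact: raddfD. Qed.

HB.instance Definition _ := GRing.Zmodule_isLmodule.Build K quotient_space
  quotient_scaleA quotient_scale1 quotient_scaleDr quotient_scaleDl.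

Definition to_quotient (v : V) : quotient_space := \pi v.

Lemma to_quotient_linear : linear to_quotient.
Proof. by move=> a u v; rewrite /to_quotient raddfD; congr (_ + _); exact: pi_scale. Qed.

HB.instance Definition _ :=
  GRing.isLinear.Build K V quotient_space _ to_quotient to_quotient_linear.

End Quotient.

Section Subquotient.
Variables (K : fieldType) (V : lmodType K) (A B : subspace V).

Fact restrict_closed : submod_closed [pred v : subspace_type A | val v \in B].
Proof.
split=> [|a u v]; rewrite !inE ?raddf0 ?rpred0 // => uB vB.
by rewrite linearP rpredD ?rpredZ.
Qed.

(* A / (A :&: B), i.e. A / B when B is contained in A *)
Definition subquotient := quotient_space (Subspace restrict_closed).
HB.instance Definition _ := GRing.Lmodule.on subquotient.

End Subquotient.

Section Hom.
Variables (K : fieldType) (U V : lmodType K).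

Definition linear_pred : {pred U -> V} := fun f => `[< linear f >].

Fact linear_pred_closed : submod_closed linear_pred.
Proof.
split=> [|a f g /asboolP f_lin /asboolP g_lin]; apply/asboolP => b x y.
  by rewrite /= scaler0 addr0.
change (a *: f (b *: x + y) + g (b *: x + y)
        = b *: (a *: f x + g x) + (a *: f y + g y)).
by rewrite f_lin g_lin !scalerDr !scalerA mulrC addrACA.
Qed.

Definition hom := subspace_type (Subspace linear_pred_closed).
HB.instance Definition _ := GRing.Lmodule.on hom.
HB.instance Definition _ := SubChoice.on hom.

Definition hom_fun (f : hom) : U -> V := val f.

Lemma hom_fun_linear f : linear (hom_fun f).
Proof. exact/asboolP/(valP f). Qed.

HB.instance Definition _ f :=
  GRing.isLinear.Build K U V _ (hom_fun f) (hom_fun_linear f).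

End Hom.

Coercion hom_fun : hom >-> Funclass.

(* A Z/2-graded space is the direct sum V_0 (+) V_1, an element being the pair
   of its components. *)
Record superspace (K : fieldType) := Superspace {
  even_part : lmodType K;
  odd_part : lmodType K
}.

Definition total (K : fieldType) (V : superspace K) : lmodType K :=
  (even_part V * odd_part V)%type.
Coercion total : superspace >-> GRing.Lmodule.type.

Section Superspaces.
Variables (K : fieldType) (V : superspace K).

Definition component (b : bool) (v : V) : V :=
  if b then (0, v.2) else (v.1, 0).

(* Homogeneous elements carry their parity, so that 0 occurs with both
   parities. *)
Definition homogeneous := (even_part V + odd_part V)%type.

Definition parity (x : homogeneous) : bool := if x is inr _ then true else false.

Definition homogeneous_val (x : homogeneous) : V :=
  match x with inl v => (v, 0) | inr v => (0, v) end.

Definition homogenize (b : bool) (v : V) : homogeneous :=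
  if b then inr v.2 else inl v.1.

End Superspaces.

Coercion homogeneous_val : homogeneous >-> GRing.Lmodule.sort.

(* These axioms are the customary ones only when 2 and 3 are invertible in K. *)
Record lieSuperalgebra (K : fieldType) := LieSuperalgebra {
  lie_space :> superspace K;
  bracket : lie_space -> lie_space -> lie_space;
  bracket_linear_l : forall y, linear (bracket^~ y);
  bracket_linear_r : forall x, linear (bracket x);
  bracket_graded : forall x y : homogeneous lie_space,
    component (parity x (+) parity y) (bracket x y) = bracket x y;
  bracket_skew : forall x y : homogeneous lie_space,
    bracket x y = - ((-1) ^+ (parity x * parity y)%N *: bracket y x);
  bracket_jacobi : forall x y z : homogeneous lie_space,
    bracket x (bracket y z) =
      bracket (bracket x y) z
      + (-1) ^+ (parity x * parity y)%N *: bracket y (bracket x z)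
}.

Record lieModule (K : fieldType) (g : lieSuperalgebra K) := LieModule {
  module_space :> superspace K;
  act : g -> module_space -> module_space;
  act_linear_l : forall m, linear (act^~ m);
  act_linear_r : forall x, linear (act x);
  act_graded : forall (x : homogeneous g) (m : homogeneous module_space),
    component (parity x (+) parity m) (act x m) = act x m;
  act_bracket : forall (x y : homogeneous g) (m : module_space),
    act (bracket x y) m =
      act x (act y m) - (-1) ^+ (parity x * parity y)%N *: act y (act x m)
}.

Section SuperExteriorPower.
Variables (K : fieldType) (V : superspace K) (p : nat).

(* An element (s, t) stands for the generator
   (s_1 /\ ... /\ s_i) (x) (t_1 ... t_j) of the summand
   Lambda^i(V_0) (x) S^j(V_1), where i = size s and j = size t; the relations
   below preserve i and j. *)
Definition generator :=
  {st : seq (even_part V) * seq (odd_part V) | size st.1 + size st.2 == p}%N.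
HB.instance Definition _ := Choice.on generator.

(* Sequences of the wrong total length are sent to 0. *)
Definition gen (s : seq (even_part V)) (t : seq (odd_part V)) :
    {freeg generator / K} :=
  if insub (s, t) is Some u then << (u : generator) >> else 0.

Inductive relation : {freeg generator / K} -> Prop :=
| EvenLinear a x y s1 s2 t :
    relation (gen (s1 ++ (a *: x + y) :: s2) t
              - (a *: gen (s1 ++ x :: s2) t + gen (s1 ++ y :: s2) t))
| OddLinear a x y s t1 t2 :
    relation (gen s (t1 ++ (a *: x + y) :: t2)
              - (a *: gen s (t1 ++ x :: t2) + gen s (t1 ++ y :: t2)))
| EvenAlternating x s1 s2 s3 t : relation (gen (s1 ++ x :: s2 ++ x :: s3) t)
| OddSymmetric s t1 t2 of perm_eq t1 t2 : relation (gen s t1 - gen s t2).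

Definition superexterior := quotient_space (span relation).
HB.instance Definition _ := GRing.Lmodule.on superexterior.

End SuperExteriorPower.

Section Wedge.
Variables (K : fieldType) (V : superspace K).

Definition evens (w : seq (homogeneous V)) : seq (even_part V) :=
  pmap (fun x => if x is inl v then Some v else None) w.

Definition odds (w : seq (homogeneous V)) : seq (odd_part V) :=
  pmap (fun x => if x is inr v then Some v else None) w.

Fixpoint inversions (w : seq (homogeneous V)) : nat :=
  if w is x :: w' then (parity x * size (evens w') + inversions w')%N else 0.

(* w_1 /\ ... /\ w_p; moving the even factors to the left costs a sign for
   each odd factor preceding an even one, as x /\ y = - (-1)^(|x||y|) y /\ x. *)
Definition wedge (p : nat) (w : seq (homogeneous V)) : superexterior V p :=
  (-1) ^+ inversions w *: to_quotient (span _) (gen p (evens w) (odds w)).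

End Wedge.

Section Cohomology.
Variables (K : fieldType) (g : lieSuperalgebra K) (M : lieModule g).

Definition cochain (p : nat) := hom (superexterior g p) M.
HB.instance Definition _ p := GRing.Lmodule.on (cochain p).
Identity Coercion hom_of_cochain : cochain >-> hom.

(* The value at w_1 /\ ... /\ w_p of the homogeneous component of degree b
   of f. *)
Definition cochain_component p (f : cochain p) (b : bool)
    (w : seq (homogeneous g)) : M :=
  component (b (+) odd (\sum_(x <- w) parity x)%N) (f (wedge p w)).

Definition hbracket (x y : homogeneous g) : homogeneous g :=
  homogenize (parity x (+) parity y) (bracket x y).

Section Differential.
Variables (p : nat) (w : 'I_p.+1 -> homogeneous g).

Definition tau (b : bool) (i : 'I_p.+1) : nat :=
  (i + parity (w i) * (\sum_(k < p.+1 | k < i) parity (w k) + b))%N.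

Definition sigma (i j : 'I_p.+1) : nat :=
  (i + j + parity (w i) * parity (w j)
  + parity (w i) * (\sum_(k < p.+1 | k < i) parity (w k))
  + parity (w j) * (\sum_(k < p.+1 | k < j) parity (w k)))%N.

Definition omit (I : pred 'I_p.+1) : seq (homogeneous g) :=
  [seq w k | k <- enum 'I_p.+1 & ~~ I k].

(* df(w_0 /\ ... /\ w_p), where f is the sum of its homogeneous components of
   degree b = 0, 1 *)
Definition differential (f : cochain p) : M :=
  \sum_(b : bool)
    (\sum_(i < p.+1)
        (-1) ^+ tau b i *: act (w i) (cochain_component f b (omit (pred1 i)))
     + \sum_(i < p.+1) \sum_(j < p.+1 | (i < j)%N)
        (-1) ^+ sigma i j *:
          cochain_component f b (hbracket (w i) (w j) :: omit (pred2 i j))).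

End Differential.


Fact cochain_componentP p b w :
  linear (fun f : cochain p => cochain_component f b w).
Proof.
move=> a f h; rewrite /cochain_component.
have -> : hom_fun (a *: f + h) (wedge p w) =
  a *: hom_fun f (wedge p w) + hom_fun h (wedge p w) by [].
case: (_ (+) _); congr pair; rewrite /= ?scaler0 ?addr0 //.
Qed.

Fact differential_linear p (w : 'I_p.+1 -> homogeneous g) :
  linear (differential (p := p) w).
Proof.
move=> a f h; rewrite /differential scaler_sumr -big_split /=.
apply: eq_bigr => b _; rewrite scalerDr addrACA; congr (_ + _).
  rewrite scaler_sumr -big_split; apply: eq_bigr => i _ /=.
  by rewrite cochain_componentP act_linear_r scalerDr !scalerA mulrC.
rewrite scaler_sumr -big_split; apply: eq_bigr => i _ /=.
rewrite scaler_sumr -big_split; apply: eq_bigr => j _ /=.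
by rewrite cochain_componentP scalerDr !scalerA mulrC.
Qed.

(* df is determined by its values on the wedge products of homogeneous
   elements, since these span the superexterior power. *)
Definition is_differential p (f : cochain p) (df : cochain p.+1) : Prop :=
  forall w : 'I_p.+1 -> homogeneous g,
    df (wedge p.+1 [seq w k | k <- enum 'I_p.+1]) = differential w f.

Definition cocycle p : {pred cochain p} := fun f => `[< is_differential f 0 >].

Definition coboundary p : {pred cochain p} :=
  match p with
  | 0 => fun f => f == 0
  | q.+1 => fun f => `[< exists h : cochain q, is_differential h f >]
  end.

Fact is_differential_linear p a (f1 f2 : cochain p) h1 h2 :
  is_differential f1 h1 -> is_differential f2 h2 ->
  is_differential (a *: f1 + f2) (a *: h1 + h2).
Proof.
by move=> dh1 dh2 w; rewrite differential_linear -dh1 -dh2.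
Qed.

Fact is_differential0 p : is_differential (0 : cochain p) 0.
Proof.
move=> w; have := differential_linear w (-1) 0 0.
by rewrite scaler0 addr0 scaleN1r addNr => ->.
Qed.

Fact cocycle_closed p : submod_closed (@cocycle p).
Proof.
split=> [|a f h /asboolP df /asboolP dh]; apply/asboolP.
  exact: is_differential0.
by have := is_differential_linear a df dh; rewrite scaler0 addr0.
Qed.

Fact coboundary_closed p : submod_closed (@coboundary p).
Proof.
case: p => [|p]; split.
- exact: eqxx.
- by move=> a f h /eqP -> /eqP ->; apply/eqP; rewrite scaler0 addr0.
- by apply/asboolP; exists 0; exact: is_differential0.
move=> a f h /asboolP [f' df'] /asboolP [h' dh']; apply/asboolP.
by exists (a *: f' + h'); exact: is_differential_linear.
Qed.

Definition cocycles p := Subspace (@cocycle_closed p).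
Definition coboundaries p := Subspace (@coboundary_closed p).

Definition cohomology p := subquotient (cocycles p) (coboundaries p).
HB.instance Definition _ p := GRing.Lmodule.on (cohomology p).

Definition superderivation : {pred hom g M} := fun phi =>
  `[< forall x y : homogeneous g,
        phi (bracket x y) =
          act x (phi y) - (-1) ^+ (parity x * parity y)%N *: act y (phi x) >].

Definition inner_superderivation : {pred hom g M} := fun phi =>
  `[< exists m : M, forall x : g, phi x = act x m >].

Fact superderivation_closed : submod_closed superderivation.
Proof.
split=> [|a f h /asboolP fP /asboolP hP]; apply/asboolP => x y.
  have act0 z : act z (0 : M) = 0.
    by have := act_linear_r z (-1) (0 : M) 0; rewrite scaler0 addr0 scaleN1r addNr.
  by rewrite -[hom_fun _ _]/0 !act0 scaler0 subr0.
have valE z : hom_fun (a *: f + h) z = a *: hom_fun f z + hom_fun h z by [].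
rewrite !valE fP hP !act_linear_r scalerBr addrACA [in RHS]scalerDr opprD.
by rewrite !scalerA mulrC.
Qed.

Fact inner_superderivation_closed : submod_closed inner_superderivation.
Proof.
split=> [|a f h /asboolP [m fm] /asboolP [n hn]]; apply/asboolP.
  exists 0 => x; have := act_linear_r x (-1) (0 : M) 0.
  by rewrite scaler0 addr0 scaleN1r addNr.
by exists (a *: m + n) => x; rewrite act_linear_r -fm -hn.
Qed.

Lemma inner_superderivation_sub phi :
  phi \in inner_superderivation -> phi \in superderivation.
Proof.
case/asboolP => m phiE; apply/asboolP => x y.
by rewrite !phiE act_bracket.
Qed.

Definition SupDer := Subspace superderivation_closed.
Definition InnSupDer := Subspace inner_superderivation_closed.

End Cohomology.

(* Main.v *)
(* A 1-cochain of degree b satisfies the cocycle condition with an extra sign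
   (-1)^(b|x|) in front of x . f(y), so it is not itself a superderivation when
   b = 1; but x |-> (-1)^(b|x|) f(x) is. Summing over b turns f into its twist
   s^|x| f(x), where s is -1 on M_0 and 1 on M_1, because f_b(x) lies in M_(b+1)
   for odd x. For phi the twist of f, one finds
   df(x, y) = s^(|x|+|y|) (x . phi(y) - (-1)^(|x||y|) y . phi(x) - phi([x, y])),
   and the differential of m in M is the twist of x |-> x . m. Twisting is an
   involution, hence it carries 1-cocycles onto superderivations and
   1-coboundaries onto inner ones. *)

Require Import Defs.
From mathcomp Require Import all_boot all_algebra.
From mathcomp Require Import reals complex.
From HB Require Import structures.
From mathcomp Require Import boolp freeg.
(* [vector] shadows [hom] and [span]. *)
Import Defs.

Set Implicit Arguments.
Unset Strict Implicit.
Unset Printing Implicit Defensive.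

Import GRing.Theory.
Local Open Scope ring_scope.
Local Open Scope quotient_scope.

(** * Linear maps induced on quotients and subquotients *)

Section Quotients.
Variable K : fieldType.

Lemma to_quotient_eq0 (V : lmodType K) (A : subspace V) v :
  v \in A -> to_quotient A v = 0.
Proof.
move=> vA; have : v - 0 \in A by rewrite subr0.
by rewrite Quotient.idealrBE => /eqP e; rewrite /to_quotient e; exact: raddf0.
Qed.

(** Universal property of the quotient: [F] evaluates [L] at a representative, and two
    representatives differ by an element of [A], which [L] kills. *)
Lemma quotient_lift (V W : lmodType K) (A : subspace V) (L : {linear V -> W}) :
  {in A, forall v, L v = 0} ->
  exists F : {linear quotient_space A -> W},
    forall v, F (to_quotient A v) = L v.
Proof.
move=> LA; pose F (x : quotient_space A) := L (repr x).
have FE v : F (to_quotient A v) = L v.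
  apply/eqP; rewrite /F -subr_eq0 -raddfB; apply/eqP/LA.
  by rewrite Quotient.idealrBE reprK.
have F_lin : linear F.
  move=> a x y; rewrite -[x]reprK -[y]reprK.
  by rewrite -!/(to_quotient _ _) -linearP !FE linearP.
pose FL := GRing.isLinear.Build K _ W _ F F_lin.
pose F' : {linear quotient_space A -> W} := HB.pack F FL.
by exists F'.
Qed.

(** The value of [F] is given through any [w] lying over [T (val v)], so that the membership proof
    carried by [w] may be arbitrary. *)
Lemma subquotient_map (V W : lmodType K) (A B : subspace V) (C D : subspace W)
    (T : {linear V -> W}) :
  {homo T : v / v \in A >-> v \in C} -> {homo T : v / v \in B >-> v \in D} ->
  exists F : {linear subquotient A B -> subquotient C D},
    forall (v : subspace_type A) (w : subspace_type C), T (val v) = val w ->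
      F (to_quotient _ v) = to_quotient _ w.
Proof.
move=> TAC TBD.
pose T0 (v : subspace_type A) : subspace_type C :=
  Sub (T (val v)) (TAC _ (valP v)).
have T0_lin : linear T0.
  by move=> a u v; apply: val_inj; rewrite /= !linearP.
pose T0L := GRing.isLinear.Build K _ _ _ T0 T0_lin.
pose T1 : {linear subspace_type A -> subspace_type C} := HB.pack T0 T0L.
pose P : {linear subspace_type C -> subquotient C D} := to_quotient _.
have [|F FE] := @quotient_lift _ _ (Subspace (restrict_closed A B)) (P \o T1).
  by move=> v vB; apply: to_quotient_eq0; rewrite inE /=; exact: TBD.
exists F => v w Tv; rewrite FE; congr (to_quotient _ _).
exact: val_inj.
Qed.

(** The inverse is the map induced by [S]. It respects the subspaces because both memberships are
    equivalences and [S] inverts [T]. *)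
Lemma subquotient_iso (V W : lmodType K) (A B : subspace V) (C D : subspace W)
    (T : {linear V -> W}) (S : {linear W -> V}) :
  cancel T S -> cancel S T ->
  (forall v, (T v \in C) = (v \in A)) -> (forall v, (T v \in D) = (v \in B)) ->
  exists F : {linear subquotient A B -> subquotient C D}, bijective F.
Proof.
move=> TK SK TC TD.
have [v|v|F FE] := @subquotient_map _ _ A B C D T; rewrite ?TC ?TD //.
have [w|w|G GE] := @subquotient_map _ _ C D A B S; rewrite -?TC -?TD ?SK //.
exists F; exists G => x; rewrite -[x]reprK.
  set v := repr x; have vC : T (val v) \in C by rewrite TC (valP v).
  rewrite (FE v (Sub (T (val v)) vC)) // (GE _ v) //=.
set w := repr x; have wA : S (val w) \in A by rewrite -TC SK (valP w).
by rewrite (GE w (Sub (S (val w)) wA)) // (FE _ w) //= SK.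
Qed.

End Quotients.

(** * Linear maps as elements of [hom], and precomposition *)

Section HomMaps.
Variables (K : fieldType).

Lemma linear_in_hom (U V : lmodType K) (L : {linear U -> V}) :
  (L : U -> V) \in Subspace (linear_pred_closed U V).
Proof. by apply/asboolP; exact: linearP. Qed.

Definition linear_hom (U V : lmodType K) (L : {linear U -> V}) : hom U V :=
  Sub (L : U -> V) (linear_in_hom L).

Lemma homP (U V : lmodType K) (f h : hom U V) : f =1 h -> f = h.
Proof. by move=> fh; apply/val_inj/funext. Qed.

Lemma hom_linearE (U V : lmodType K) a (f h : hom U V) x :
  hom_fun (a *: f + h) x = a *: f x + h x.
Proof. by []. Qed.

Section Precomposition.
Variables (U V W : lmodType K) (L : {linear U -> V}).

Definition precomp (f : hom V W) : hom U W := linear_hom (f \o L).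

Fact precomp_linear : linear precomp.
Proof. by move=> a f h; apply: homP. Qed.

HB.instance Definition _ := GRing.isLinear.Build K _ _ _ precomp precomp_linear.

End Precomposition.
End HomMaps.

(** * Linear extension from a basis of a free module *)

Section FreeModules.
Variables (K : nzRingType) (G : choiceType).

Lemma freeg_scaleU (c k : K) (u : G) :
  c *: << k *g u >> = << (c * k) *g u >> :> {freeg G / K}.
Proof. by apply/eqP/freeg_eqP => v; rewrite coeffZ !coeffU mulrA. Qed.

(** Additivity of the lift is already known. For scalars, [x] is expanded over its basis elements,
    where the lift is explicit. *)
Lemma fglift_linear (W : lmodType K) (f : G -> W) :
  linear (fglift f : {freeg G / K} -> W).
Proof.
pose fA := GRing.isZmodMorphism.Build _ _ (fglift f) (lift_is_additive f).
pose F : {additive {freeg G / K} -> W} := HB.pack (fglift f) fA.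
move=> a x y; rewrite -[LHS]/(F (a *: x + y)) raddfD; congr (_ + _).
rewrite -[fglift f x]/(F x) -[in RHS](freeg_sumE x) -[a *: x]/(fgscale a x).
rewrite /fgscale !raddf_sum.
by apply: eq_bigr => u _; rewrite /= !liftU scalerA.
Qed.

End FreeModules.

(** * Universal property of the super exterior power *)

Section SuperExteriorMaps.
Variables (K : fieldType) (V : superspace K) (p : nat).

Definition decomposable (s : seq (even_part V)) (t : seq (odd_part V)) :
  superexterior V p := to_quotient (span _) (gen p s t).

Lemma decomposable_relation r : relation r ->
  to_quotient (span (@relation K V p)) r = 0.
Proof. by move=> rr; apply/to_quotient_eq0/asboolP => A; apply. Qed.

Lemma superexterior_ext (W : lmodType K)
    (L1 L2 : {linear superexterior V p -> W}) :
  (forall s t, (size s + size t)%N = p ->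
     L1 (decomposable s t) = L2 (decomposable s t)) -> L1 =1 L2.
Proof.
move=> L12 x; rewrite -[x]reprK -!/(to_quotient _ _).
pose N (L : {linear superexterior V p -> W}) :
  {linear {freeg (generator V p) / K} -> W} := L \o to_quotient (span _).
rewrite -[LHS]/(N L1 (repr x)) -[RHS]/(N L2 (repr x)).
rewrite -[repr x]freeg_sumE !raddf_sum; apply: eq_bigr => u _.
rewrite -[coeff _ _]mulr1 -freeg_scaleU /= !linearZZ; congr (_ *: _).
case: u => -[s t] st.
have := L12 s t (eqP st); rewrite /decomposable /gen.
case: insubP => [u _ e|/negP[]//]; rewrite (_ : u = Sub (s, t) st) //.
exact: val_inj.
Qed.

(** [F] extends linearly to the free module, and its hypotheses say that the four kinds of relations
    die. They are required only in total length [p], since [gen] is 0 in any other length. *)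
Lemma superexterior_lift (W : lmodType K)
    (F : seq (even_part V) -> seq (odd_part V) -> W) :
  (forall a x y s1 s2 t, (size s1 + size s2 + size t).+1 = p ->
     F (s1 ++ (a *: x + y) :: s2) t =
       a *: F (s1 ++ x :: s2) t + F (s1 ++ y :: s2) t) ->
  (forall a x y s t1 t2, (size s + size t1 + size t2).+1 = p ->
     F s (t1 ++ (a *: x + y) :: t2) =
       a *: F s (t1 ++ x :: t2) + F s (t1 ++ y :: t2)) ->
  (forall x s1 s2 s3 t, (size s1 + size s2 + size s3 + size t).+2 = p ->
     F (s1 ++ x :: s2 ++ x :: s3) t = 0) ->
  (forall s t1 t2, (size s + size t1)%N = p -> perm_eq t1 t2 ->
     F s t1 = F s t2) ->
  exists L : {linear superexterior V p -> W}, forall s t,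
    (size s + size t)%N = p -> L (decomposable s t) = F s t.
Proof.
move=> Flin0 Flin1 Falt Fsym.
pose G (u : generator V p) := F (val u).1 (val u).2.
have [L0 L0gen] : exists L0 : {linear {freeg (generator V p) / K} -> W},
    forall s t, L0 (gen p s t) = if (size s + size t == p)%N then F s t else 0.
  pose GL := GRing.isLinear.Build K _ _ _ (fglift G) (fglift_linear G).
  pose L0 : {linear {freeg (generator V p) / K} -> W} := HB.pack (fglift G) GL.
  exists L0 => s t; rewrite /gen.
  case: insubP => [u /= -> uE|/negbTE /= ->]; last exact: (raddf0 L0).
  by rewrite /= liftU scale1r /G /=; case: u uE => -[s0 t0] e /= [-> ->].
have [|L LE] := @quotient_lift _ _ _ (span (@relation K V p)) L0.
  move=> v /asboolP.
  (* The span lies in every subspace containing the relations. As the kernel of [L0] is a subspace,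
     it suffices to check each relation. *)
  have ker_closed : submod_closed [pred v | L0 v == 0].
    split=> [|a x y]; rewrite !inE ?raddf0 // => /eqP x0 /eqP y0.
    by rewrite linearP x0 y0 scaler0 addr0.
  move=> /(_ (Subspace ker_closed)) h; apply/eqP; apply: h => {v} _ [].
  - move=> a x y s1 s2 t; rewrite inE linearB linearP !L0gen.
    rewrite !size_cat /= !addnS addSn.
    case: (_ =P p) => e; last by rewrite scaler0 addr0 subr0.
    by rewrite Flin0 ?subrr.
  - move=> a x y s t1 t2; rewrite inE linearB linearP !L0gen.
    rewrite !size_cat /= !addnS addnA.
    case: (_ =P p) => e; last by rewrite scaler0 addr0 subr0.
    by rewrite Flin1 ?subrr.
  - move=> x s1 s2 s3 t; rewrite inE L0gen.
    case: (_ =P p) => // e; rewrite Falt ?eqxx //.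
    by rewrite -e !size_cat /= size_cat /= !(addnS, addSn) !addnA.
  move=> s t1 t2 t12; rewrite inE linearB !L0gen (perm_size t12).
  case: (_ =P p) => e; last by rewrite subr0.
  by rewrite (Fsym _ _ t2) ?subrr ?(perm_size t12).
exists L => s t st; rewrite LE L0gen st eqxx //.
Qed.

End SuperExteriorMaps.

(** * The first and zeroth super exterior powers *)

Section DegreeOne.
Variables (K : fieldType) (V : superspace K).

Definition to_degree1 (x : V) : superexterior V 1 :=
  decomposable 1 [:: x.1] [::] + decomposable 1 [::] [:: x.2].

Lemma decomposable1_even_linear :
  linear (fun x : even_part V => decomposable 1 [:: x] [::]).
Proof.
move=> a x y.
have := decomposable_relation (EvenLinear (V := V) 1 a x y [::] [::] [::]).
by rewrite linearB linearP => /eqP; rewrite subr_eq0 => /eqP.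
Qed.

Lemma decomposable1_odd_linear :
  linear (fun x : odd_part V => decomposable 1 [::] [:: x]).
Proof.
move=> a x y.
have := decomposable_relation (OddLinear (V := V) 1 a x y [::] [::] [::]).
by rewrite linearB linearP => /eqP; rewrite subr_eq0 => /eqP.
Qed.

Fact to_degree1_linear : linear to_degree1.
Proof.
move=> a x y; rewrite /to_degree1 decomposable1_even_linear.
by rewrite decomposable1_odd_linear scalerDr addrACA.
Qed.

HB.instance Definition _ :=
  GRing.isLinear.Build K V (superexterior V 1) _ to_degree1 to_degree1_linear.

(** The absent component of [x] contributes a decomposable with entry 0, which vanishes by
    linearity. *)
Lemma wedge1 (x : homogeneous V) : wedge 1 [:: x] = to_degree1 x.
Proof.
have even0 : decomposable 1 [:: 0 : even_part V] [::] = 0.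
  have := decomposable1_even_linear (-1) 0 0.
  by rewrite scaler0 addr0 scaleN1r addNr.
have odd0 : decomposable 1 [::] [:: 0 : odd_part V] = 0.
  have := decomposable1_odd_linear (-1) 0 0.
  by rewrite scaler0 addr0 scaleN1r addNr.
case: x => v; rewrite /wedge /to_degree1 /= expr0 scale1r.
  by rewrite odd0 addr0.
by rewrite even0 add0r.
Qed.

Lemma to_degree1_bij : exists pr : {linear superexterior V 1 -> V},
  cancel to_degree1 pr /\ cancel pr to_degree1.
Proof.
(* In total length 1 exactly one of the two sequences is empty, and the default 0 of [head] is then
   the right value for that component. *)
pose F (s : seq (even_part V)) (t : seq (odd_part V)) : V :=
  (head 0 s, head 0 t).
have [|||| pr prE] := @superexterior_lift _ V 1 _ F.
- move=> a x y [|? ?] [|? ?] [|? ?] //= _.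
  by congr pair; rewrite /= scaler0 addr0.
- move=> a x y [|? ?] [|? ?] [|? ?] //= _.
  by congr pair; rewrite /= scaler0 addr0.
- by [].
- move=> s t1 t2 st /[dup] /perm_size t12 /perm_small_eq -> //.
  by rewrite -t12 -st leq_addl.
exists pr; split=> [[x0 x1]|x].
  rewrite /to_degree1 linearD !prE // /F /=.
  by congr pair; rewrite /= ?addr0 ?add0r.
(* A decomposable of degree 1 is the wedge of a single homogeneous element, so the two maps need
   only be compared there. *)
move: x; apply: (@superexterior_ext _ V 1 _ (to_degree1 \o pr) idfun).
case=> [|x [|? ?]] [|y [|? ?]] //= _; rewrite prE //.
  by have := wedge1 (inr y); rewrite /wedge /= expr0 scale1r.
by have := wedge1 (inl x); rewrite /wedge /= expr0 scale1r.
Qed.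

End DegreeOne.

(** The constant function lifts: in length 0 the linearity and alternation conditions are
    vacuous. *)
Lemma cochain0_exists (K : fieldType) (V : superspace K) (W : lmodType K)
    (m : W) :
  exists h : {linear superexterior V 0 -> W}, h (wedge 0 [::]) = m.
Proof.
have [||||h hE] := @superexterior_lift _ V 0 _ (fun _ _ => m) => //.
by exists h; rewrite /wedge expr0 scale1r hE.
Qed.

(** * The sign involution and the twist of a linear map *)

Section Twist.
Variables (K : fieldType).

(** The power [s^b] of the involution [s] that is -1 on the even part and 1 on the odd part. *)
Definition sign_conj (V : superspace K) (b : bool) (v : V) : V :=
  if b then (- v.1, v.2) else v.

Section SignConj.
Variable V : superspace K.
Implicit Types v : V.

Fact sign_conj_linear b : linear (@sign_conj V b).
Proof.
by case: b => a u v //; congr pair => /=; rewrite opprD scalerN.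
Qed.

HB.instance Definition _ b :=
  GRing.isLinear.Build K V V _ (@sign_conj V b) (sign_conj_linear b).

Lemma sign_conj_add b c v : sign_conj b (sign_conj c v) = sign_conj (b (+) c) v.
Proof. by case: b c v => -[] [v0 v1] //; congr pair => /=; rewrite opprK. Qed.

Lemma sign_conj_component (b q : bool) v :
  sign_conj b (component q v) = (-1) ^+ (b * ~~ q)%N *: component q v.
Proof.
case: b q => -[] //=; rewrite ?expr0 ?scale1r // /sign_conj /=.
  by rewrite oppr0.
by rewrite expr1 scaleN1r; congr pair; rewrite /= oppr0.
Qed.

(** For [b = 1] the component of parity [r] occurs for [c = r + q], hence with sign [(-1)^(r+q)].
    This is [(-1)^(q+1)] times [(-1)^(r+1)], the eigenvalue of [s] in parity [r]. *)
Lemma sum_component (b q : bool) v :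
  \sum_(c : bool) (-1) ^+ (b * c)%N *: component (c (+) q) v
    = (-1) ^+ (b * ~~ q)%N *: sign_conj b v.
Proof.
rewrite big_bool.
case: b q v => -[] [v0 v1] /=; rewrite ?mul1n ?expr0 ?expr1 ?scale1r ?scaleN1r;
  congr pair; rewrite /= ?oppr0 ?opprK ?add0r ?addr0 //.
Qed.

End SignConj.

Section TwistHom.
Variables U V : superspace K.

Fact twist_linear (f : hom U V) :
  linear (fun x : U => f (x.1, 0) + sign_conj true (f (0, x.2))).
Proof.
move=> a x y.
have -> : ((a *: x + y).1, 0) = a *: (x.1, 0) + (y.1, 0) :> U.
  by congr pair; rewrite /= scaler0 addr0.
have -> : (0, (a *: x + y).2) = a *: (0, x.2) + (0, y.2) :> U.
  by congr pair; rewrite /= scaler0 addr0.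
by rewrite !linearP scalerDr addrACA.
Qed.

Definition twist (f : hom U V) : hom U V :=
  Sub (fun x : U => f (x.1, 0) + sign_conj true (f (0, x.2)))
    (asboolT (twist_linear f)).

Fact twist_hom_linear : linear twist.
Proof.
move=> a f h; apply: homP => x; rewrite hom_linearE.
rewrite -[LHS]/(_ + sign_conj true _) !hom_linearE linearP.
by rewrite addrACA -scalerDr.
Qed.

HB.instance Definition _ :=
  GRing.isLinear.Build K (hom U V) (hom U V) _ twist twist_hom_linear.

Lemma twistE (f : hom U V) (x : homogeneous U) :
  twist f x = sign_conj (parity x) (f x).
Proof.
case: x => x; rewrite -[LHS]/(_ + sign_conj true _) /= linear0.
  by rewrite linear0 addr0.
by rewrite add0r.
Qed.

Lemma hom_homogeneousP (f h : hom U V) :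
  (forall x : homogeneous U, f x = h x) -> f = h.
Proof.
move=> fh; apply: homP => -[x0 x1].
have -> : (x0, x1) = homogeneous_val (inl x0) + homogeneous_val (inr x1) :> U.
  by congr pair; rewrite /= ?addr0 ?add0r.
by rewrite !linearD; congr (_ + _); exact: fh.
Qed.

Lemma twistK : involutive twist.
Proof.
move=> f; apply: hom_homogeneousP => x.
by rewrite !twistE sign_conj_add addbb.
Qed.

End TwistHom.
End Twist.

(** * The differentials of 0-cochains and 1-cochains *)

Section LowDegreeDifferentials.
Variables (K : fieldType) (g : lieSuperalgebra K) (M : lieModule g).

HB.instance Definition _ (x : g) :=
  GRing.isLinear.Build K M M _ (act x) (act_linear_r x).

(** The action of an odd [x] exchanges the two eigenspaces of [s], so it anticommutes with [s]; an
    even [x] preserves them and commutes with it. *)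
Lemma act_sign_conj (x : homogeneous g) b (m : M) :
  act x (sign_conj b m) = (-1) ^+ (b * parity x)%N *: sign_conj b (act x m).
Proof.
case: b; last by rewrite scale1r.
case: m => m0 m1.
have -> : (m0, m1) = homogeneous_val (inl m0) + homogeneous_val (inr m1) :> M.
  by congr pair; rewrite /= ?addr0 ?add0r.
have s0 : sign_conj true (homogeneous_val (inl m0) : M) =
    - homogeneous_val (inl m0).
  by congr pair; rewrite /= oppr0.
have s1 : sign_conj true (homogeneous_val (inr m1) : M) =
    homogeneous_val (inr m1).
  by congr pair; rewrite /= oppr0.
have sact n : sign_conj true (act x (homogeneous_val n)) =
    (-1) ^+ (~~ (parity x (+) parity n)) *: act x (n : M).
  by rewrite -{1}act_graded sign_conj_component act_graded mul1n.
have sD : {morph @sign_conj _ M true : u v / u + v} := linearD _.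
have actD : {morph act x : u v / (u : M) + v} := linearD _.
have actN : {morph act x : u / - (u : M)} := linearN _.
rewrite sD !actD sD s0 s1 actN !sact scalerDr !scalerA mul1n.
case: (parity x); rewrite /= ?expr0 ?expr1 ?mulr1 ?mulrN1 ?mul1r ?opprK;
  by rewrite ?scaleN1r ?scale1r.
Qed.

(** Collects the terms [x . f_c(y)] of the differential over both degrees [c], with [q] the parity
    of [y] and [m = f(y)]. *)
Lemma sum_act_component (x : homogeneous g) q (m : M) :
  \sum_(c : bool) (-1) ^+ (parity x * c)%N *: act x (component (c (+) q) m)
    = (-1) ^+ (parity x * q)%N *: sign_conj (parity x) (act x m).
Proof.
under eq_bigr do rewrite -linearZZ.
rewrite -linear_sum sum_component linearZZ /= act_sign_conj scalerA -exprD.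
by congr (_ *: _); case: (parity x); case: q; rewrite //= ?expr0 ?sqrrN ?expr1n.
Qed.

Lemma differential0 (w : 'I_1 -> homogeneous g) (h : cochain M 0) :
  differential w h =
    sign_conj (parity (w ord0)) (act (w ord0) (h (wedge 0 [::]))).
Proof.
have := sum_act_component (w ord0) false (h (wedge 0 [::])).
rewrite muln0 scale1r => <-; apply: eq_bigr => b _.
rewrite !big_ord1 big_pred0 ?addr0; last by case=> [[]].
congr (_ *: act _ _).
  by rewrite /tau big_pred0.
rewrite /cochain_component (_ : omit w _ = [::]) ?big_nil //.
by rewrite /omit enum_ordSl enum_ord0.
Qed.

(** The hypothesis says that [phi] is the twist of [f], because [s] is an involution. *)
Lemma differential1 (w : 'I_2 -> homogeneous g) (f : cochain M 1)
    (phi : hom g M) :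
  (forall x : homogeneous g,
     f (wedge 1 [:: x]) = sign_conj (parity x) (phi x)) ->
  let x := w ord0 in let y := w (fintype.lift ord0 ord0) in
  differential w f = sign_conj (parity x (+) parity y)
    (act x (phi y) - (-1) ^+ (parity x * parity y)%N *: act y (phi x)
     - phi (bracket x y)).
Proof.
move=> fE x y; rewrite /differential.
have omit0 : omit w (pred1 ord0) = [:: y].
  by rewrite /omit !enum_ordSl enum_ord0.
have omit1 : omit w (pred1 (fintype.lift ord0 ord0)) = [:: x].
  by rewrite /omit !enum_ordSl enum_ord0.
have omit01 : omit w (pred2 ord0 (fintype.lift ord0 ord0)) = [::].
  by rewrite /omit !enum_ordSl enum_ord0.
have tau0 b : tau w b ord0 = (parity x * b)%N.
  by rewrite /tau big_pred0.
have tau1 b : tau w b (fintype.lift ord0 ord0) =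
    (parity y * b + (parity y * parity x).+1)%N.
  rewrite /tau big_mkcond !big_ord_recl big_ord0 /= !addn0 mulnDr -/x -/y.
  rewrite /bump /=.
  by rewrite addn0 add1n addnS; congr _.+1; exact: addnC.
(* The product of the parities occurs twice in the exponent and cancels, leaving [0 + 1] from the
   indices. *)
have sigma01 : (-1) ^+ sigma w ord0 (fintype.lift ord0 ord0) = -1 :> K.
  rewrite /sigma big_pred0 // big_mkcond !big_ord_recl big_ord0 /= !addn0.
  rewrite -/x -/y muln0 addn0 /bump /= add0n addn0.
  rewrite -addnA [(parity y * _)%N]mulnC addnn.
  by rewrite -signr_odd oddS odd_double.
have fwE b z : cochain_component f b [:: z] =
    component (b (+) parity z) (sign_conj (parity z) (phi z)).
  by rewrite /cochain_component big_seq1 fE; case: (parity z).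
have bracketE : homogeneous_val (hbracket x y) = bracket x y.
  by rewrite -[RHS]bracket_graded /hbracket; case: (_ (+) _).
have parity_bracket : parity (hbracket x y) = parity x (+) parity y.
  by rewrite /hbracket; case: (_ (+) _).
transitivity (\sum_(b : bool)
   ((-1) ^+ (parity x * b)%N *: act x (component (b (+) parity y)
      (sign_conj (parity y) (phi y)))
    - (-1) ^+ (parity x * parity y)%N *: ((-1) ^+ (parity y * b)%N *:
      act y (component (b (+) parity x) (sign_conj (parity x) (phi x))))
    - component (b (+) (parity x (+) parity y))
        (sign_conj (parity x (+) parity y) (phi (bracket x y))))).
  apply: eq_bigr => b _.
  rewrite !big_ord_recl !big_ord0 !addr0 !(big_mkcond (fun j => _ < _)%N).
  rewrite !(big_ord_recl, big_ord0) /= !(addr0, add0r).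
  rewrite omit0 omit1 omit01 tau0 tau1 sigma01 -/x -/y !fwE.
  rewrite parity_bracket bracketE exprD exprS.
  rewrite scaleN1r mulN1r mulrN scaleNr scalerA.
  by rewrite [(parity y * parity x)%N]mulnC [in RHS]mulrC.
rewrite !big_split /= !sumrN -scaler_sumr !sum_act_component.
(* The bracket term carries no sign depending on the degree, so summing over degrees just
   reassembles the vector. *)
have -> (q : bool) (v : M) : \sum_(b : bool) component (b (+) q) v = v.
  rewrite big_bool; case: q v => -[v0 v1];
  by congr pair; rewrite /= ?addr0 ?add0r.
have sZ b c (v : M) : sign_conj b (c *: v) = c *: sign_conj b v.
  exact: linearZZ.
(* Moving [s] out of each action gives a second factor [(-1)^(|x||y|)], which cancels the one
   produced by the sum over degrees. *)
rewrite !act_sign_conj !linearB /= !sZ !sign_conj_add.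
rewrite [(parity y * _)%N]mulnC [parity y (+) _]addbC.
rewrite !scalerA -!exprD addnn exprD.
by rewrite -[_ ^+ _.*2]signr_odd odd_double scale1r mul1r.
Qed.

End LowDegreeDifferentials.

(** * The isomorphism on first cohomology *)

Theorem cohomology1_iso (K : fieldType) (g : lieSuperalgebra K)
    (M : lieModule g) :
  exists f : {linear cohomology M 1 -> subquotient (SupDer M) (InnSupDer M)},
    bijective f.
Proof.
have [pr [prK degK]] := to_degree1_bij g.
pose D : {linear g -> superexterior g 1} := @to_degree1 _ g.
(* [T] reads a 1-cochain as a map on [g] and then twists it; [S] undoes these two steps in reverse
   order. *)
pose T : {linear cochain M 1 -> hom g M} := @twist _ g M \o @precomp _ _ _ M D.
pose S : {linear hom g M -> cochain M 1} := @precomp _ _ _ M pr \o @twist _ g M.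
have TE (f : cochain M 1) (x : homogeneous g) :
    (T f : hom g M) x = sign_conj (parity x) (f (wedge 1 [:: x])).
  by rewrite wedge1 -[LHS]/(twist _ x) twistE.
have fE (f : cochain M 1) (x : homogeneous g) :
    f (wedge 1 [:: x]) = sign_conj (parity x) ((T f : hom g M) x).
  by rewrite TE sign_conj_add addbb.
apply: (@subquotient_iso _ _ _ _ _ _ _ T S).
- move=> f; rewrite /T /S /= twistK; apply: homP => x.
  by rewrite -[LHS]/(hom_fun f (to_degree1 (pr x))) degK.
- move=> phi; rewrite /T /S /=.
  have -> : @precomp _ _ _ M D (@precomp _ _ _ M pr (twist phi)) = twist phi.
    by apply: homP => x; rewrite -[LHS]/(twist phi (pr (to_degree1 x))) prK.
  exact: twistK.
- move=> f; apply/asboolP/asboolP => [der w | cocyc x y].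
    rewrite (differential1 w (fE f)) der subrr linear0 //.
  pose w (i : 'I_2) := if i == ord0 then x else y.
  have := cocyc w; rewrite (differential1 w (fE f)) -[LHS]/(0 : M).
  (* Applying the same power of [s] again removes it from the differential and leaves the
     superderivation identity. *)
  move/(congr1 (sign_conj (parity x (+) parity y))).
  rewrite linear0 sign_conj_add addbb /= => /esym/eqP.
  by rewrite subr_eq0 => /eqP ->.
move=> f; apply/asboolP/asboolP => [[m fm] | [h dh]].
  (* The cochain whose differential is [f] takes the value [m] at the empty wedge. *)
  have [h hm] := cochain0_exists g m.
  exists (linear_hom h) => w.
  rewrite differential0 -[in RHS]/(h _) hm -fm -fE.
  by rewrite enum_ordSl enum_ord0.
set m := h (wedge 0 [::]).
pose phi : hom g M := Sub (fun x : g => act x m) (asboolT (act_linear_l m)).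
suff -> : T f = phi by exists m.
apply: hom_homogeneousP => x; rewrite TE.
have := dh (fun _ => x); rewrite differential0 enum_ordSl enum_ord0 /= => ->.
by rewrite sign_conj_add addbb.
Qed.

Theorem proposition4p1p2 (R : realType) (g : lieSuperalgebra R[i])
    (M : lieModule g) :
  exists f : {linear cohomology M 1 -> subquotient (SupDer M) (InnSupDer M)},
    bijective f.
Proof. exact: cohomology1_iso. Qed.
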